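(* Let $\phi_\beta$ be the automorphism of the free group $\pi_1=\langle\alpha,\beta,\gamma\rangle$ defined by $$\alpha\mapsto\alpha^{-1},\qquad \beta\mapsto\alpha^{-1}\beta^{-1}\alpha,\qquad \gamma\mapsto(\beta\alpha)^{-1}\gamma^{-1}(\beta\alpha).$$ Then the action of the map $I_b$ induced by $\phi_\beta$ in the coordinates $(a,b,c)$ (with $b\neq 1$) is $$I_b:\begin{pmatrix} a \\ b \\ c \end{pmatrix}\mapsto\begin{pmatrix} a(b-1) \\ b/(b-1) \\ c(b-1) \end{pmatrix};$$ that is, the representation $\rho_{(a,b,c)}\circ\phi_\beta$ has the same character as $\rho_{I_b(a,b,c)}$.
   Context: For $(a,b,c)\in\mathbb{R}^3$, $\rho_{(a,b,c)}:\pi_1\to SL_2(\mathbb{R})$ denotes the representation of the free group $\pi_1=\langle\alpha,\beta,\gamma\rangle$ with $\rho(\alpha)=A$, $\rho(\beta)=B$, $\rho(\gamma)=C$, where $$A=\begin{pmatrix} 1 & 0 \\ a & 1 \end{pmatrix},\quad B=\begin{pmatrix} 1+b & -b \\ b & 1-b \end{pmatrix},\quad C=\begin{pmatrix} 1 & -c \\ 0 & 1 \end{pmatrix}.$$ The character of a representation $\rho$ is the function $\eta\mapsto\operatorname{tr}\rho(\eta)$ on $\pi_1$. The numbers $(a,b,c)$ are used as coordinates on the character variety, and an automorphism acts by precomposition on representations. *)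

(* Defs.v *)
From HB Require Import structures.
From mathcomp Require Import all_boot all_order all_fingroup all_algebra.
From mathcomp Require Import reals.

Set Implicit Arguments.
Unset Strict Implicit.
Unset Printing Implicit Defensive.

Import GroupScope GRing.Theory.
Local Open Scope ring_scope.

(* On groups, [{multiplicative G -> H}] is the type of group homomorphisms. *)
Lemma mult1 (G H : groupType) (f : {multiplicative G -> H}) : f 1%g = 1%g.
Proof. by apply: (mulgI (f 1%g)); rewrite -gmulfM !mulg1. Qed.

Lemma multV (G H : groupType) (f : {multiplicative G -> H}) :
  {morph f : x / x^-1%g}.
Proof. by move=> x; apply: (mulgI (f x)); rewrite -gmulfM !mulgV mult1. Qed.

(* The letter [(x, false)] stands for the generator x and [(x, true)] for its
   inverse; a free group element is represented by its unique reduced word. *)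
Section Words.
Variable X : choiceType.
Implicit Types (l m : X * bool) (s t u : seq (X * bool)).

Definition letter_inv l := (l.1, ~~ l.2).

Definition reduced s := sorted (fun l m => m != letter_inv l) s.

Definition push l s :=
  if s is m :: s' then (if m == letter_inv l then s' else l :: s) else [:: l].

Definition word_mul s t := foldr push t s.

Definition word_inv s := rev (map letter_inv s).

Lemma letter_invK : involutive letter_inv.
Proof. by case=> x b; rewrite /letter_inv /= negbK. Qed.

Lemma reduced_cons l s : reduced (l :: s) -> reduced s.
Proof. by case: s => //= m s /andP[]. Qed.

Lemma push_reduced l s : reduced s -> reduced (push l s).
Proof.
case: s => //= m s rs; case: ifP => [_|/negbT nm]; last by rewrite /= nm.
exact: reduced_cons rs.
Qed.

Lemma push_cons l s : reduced (l :: s) -> push l s = l :: s.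
Proof. by case: s => //= m s /andP[/negbTE ->]. Qed.

Lemma pushK l s : reduced s -> push l (push (letter_inv l) s) = s.
Proof.
case: s => [|m s] /=; first by rewrite eqxx.
rewrite letter_invK; case: eqP => [-> rs|_ _]; last by rewrite /= eqxx.
by rewrite push_cons.
Qed.

Lemma word_mul_reduced s t : reduced t -> reduced (word_mul s t).
Proof. by move=> rt; elim: s => //= l s IH; apply: push_reduced. Qed.

Lemma word_inv_reduced s : reduced s -> reduced (word_inv s).
Proof.
rewrite /word_inv /reduced rev_sorted sorted_map; apply: sub_sorted => l m /=.
by rewrite letter_invK (inv_eq letter_invK) eq_sym (inv_eq letter_invK) eq_sym.
Qed.

Lemma word_mul_push l s t :
  reduced t -> word_mul (push l s) t = push l (word_mul s t).
Proof.
move=> rt; case: s => //= m s; case: eqP => [->|//].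
by rewrite pushK //; apply: word_mul_reduced.
Qed.

Lemma word_mulA s t u :
  reduced u -> word_mul s (word_mul t u) = word_mul (word_mul s t) u.
Proof. by move=> ru; elim: s => //= l s ->; rewrite word_mul_push. Qed.

Lemma word_mul1 s : reduced s -> word_mul s [::] = s.
Proof.
elim: s => //= l s IH rs; rewrite IH ?push_cons //; exact: reduced_cons rs.
Qed.

Lemma word_mulV s : reduced s -> word_mul (word_inv s) s = [::].
Proof.
elim: s => //= l s IH rs; rewrite /word_inv /= rev_cons /word_mul foldr_rcons /=.
by rewrite letter_invK eqxx; apply/IH/(reduced_cons rs).
Qed.

Lemma word_invK : involutive word_inv.
Proof.
move=> s; rewrite /word_inv map_rev revK -map_comp -[RHS]map_id.
by apply: eq_map => l /=; rewrite letter_invK.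
Qed.

End Words.

Record free_group (X : choiceType) :=
  FreeGroup { word :> seq (X * bool); wordP : reduced word }.

HB.instance Definition _ (X : choiceType) := [isSub for @word X].
HB.instance Definition _ (X : choiceType) := [Choice of free_group X by <:].

Section FreeGroup.
Variable X : choiceType.
Implicit Types (x : X) (g h : free_group X).

Definition free_one := @FreeGroup X [::] isT.
Definition free_mul g h := FreeGroup (word_mul_reduced g (wordP h)).
Definition free_inv g := FreeGroup (word_inv_reduced (wordP g)).

Lemma free_mulA : associative free_mul.
Proof. by move=> g h k; apply/val_inj/word_mulA/wordP. Qed.
Lemma free_mul1g : left_id free_one free_mul.
Proof. by move=> g; apply: val_inj. Qed.
Lemma free_mulg1 : right_id free_one free_mul.
Proof. by move=> g; apply/val_inj/word_mul1/wordP. Qed.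
Lemma free_mulVg : left_inverse free_one free_inv free_mul.
Proof. by move=> g; apply/val_inj/word_mulV/wordP. Qed.
Lemma free_mulgV : right_inverse free_one free_inv free_mul.
Proof.
move=> g; rewrite -[X in free_mul X](_ : free_inv (free_inv g) = g).
  exact: free_mulVg.
exact/val_inj/word_invK.
Qed.

HB.instance Definition _ := isGroup.Build (free_group X)
  free_mulA free_mul1g free_mulg1 free_mulVg free_mulgV.

Definition free_gen x : free_group X := @FreeGroup X [:: (x, false)] isT.

(* Universal property: [free_lift f] is the unique homomorphism sending each
   generator [free_gen x] to [f x]. *)
Section Lift.
Variables (G : groupType) (f : X -> G).

Definition letter_eval (l : X * bool) : G := if l.2 then (f l.1)^-1%g else f l.1.

Definition word_eval (s : seq (X * bool)) : G :=
  foldr (fun l u => letter_eval l * u)%g 1%g s.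

Definition free_lift g : G := word_eval g.

Lemma word_eval_push l s : word_eval (push l s) = (letter_eval l * word_eval s)%g.
Proof.
case: s => //= m s; case: eqP => // ->; rewrite mulgA.
by case: l => x [] /=; rewrite /letter_eval /= (mulVg, mulgV) mul1g.
Qed.

Lemma free_liftM : {morph free_lift : g h / (g * h)%g}.
Proof.
move=> g h; rewrite /free_lift /=.
by elim: (word g) => /= [|l s IH]; rewrite ?mul1g // word_eval_push IH mulgA.
Qed.

Lemma free_lift1 : free_lift 1%g = 1%g. Proof. by []. Qed.

HB.instance Definition _ := isUMagmaMorphism.Build (free_group X) G free_lift
  (free_lift1, free_liftM).

Lemma free_lift_gen x : free_lift (free_gen x) = f x.
Proof. exact: mulg1. Qed.

Lemma free_lift_uniq (h : {multiplicative free_group X -> G}) :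
  (forall x, h (free_gen x) = f x) -> h =1 free_lift.
Proof.
move=> hE [s rs]; elim: s rs => [|[x b] s IH] rs.
  by rewrite (_ : FreeGroup rs = 1%g) ?mult1 //; apply: val_inj.
have rs' := reduced_cons rs.
pose gx := if b then (free_gen x)^-1%g else free_gen x.
have -> : FreeGroup rs = (gx * FreeGroup rs')%g.
  by apply: val_inj; rewrite /gx -[LHS](push_cons rs); case: (b).
rewrite gmulfM free_liftM IH; congr (_ * _)%g.
have liftV : free_lift (free_gen x)^-1%g = (f x)^-1%g.
  by rewrite -[in RHS]free_lift_gen; apply: (multV free_lift).
rewrite /gx; case: (b); first by rewrite multV hE; apply/esym/liftV.
by rewrite hE; apply/esym/free_lift_gen.
Qed.

End Lift.
End FreeGroup.

Record SL (n : nat) (R : comUnitRingType) :=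
  MkSL { SLval :> 'M[R]_n; SLvalP : \det SLval == 1 }.

HB.instance Definition _ n R := [isSub for @SLval n R].
HB.instance Definition _ n R := [Choice of SL n R by <:].

Section SL.
Variables (n : nat) (R : comUnitRingType).
Implicit Types M N : SL n R.

Lemma SL_one_subproof : \det (1%:M : 'M[R]_n) == 1.
Proof. by rewrite det1. Qed.
Lemma SL_mul_subproof M N : \det (M *m N) == 1.
Proof. by rewrite det_mulmx (eqP (SLvalP M)) (eqP (SLvalP N)) mulr1. Qed.
Lemma SL_inv_subproof M : \det (invmx M) == 1.
Proof. by rewrite det_inv (eqP (SLvalP M)) invr1. Qed.
Lemma SL_unitmx M : (M : 'M_n) \in unitmx.
Proof. by rewrite unitmxE (eqP (SLvalP M)) unitr1. Qed.

Definition SL_one := MkSL SL_one_subproof.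
Definition SL_mul M N := MkSL (SL_mul_subproof M N).
Definition SL_inv M := MkSL (SL_inv_subproof M).

Lemma SL_mulA : associative SL_mul.
Proof. by move=> M N P; apply/val_inj/mulmxA. Qed.
Lemma SL_mul1g : left_id SL_one SL_mul.
Proof. by move=> M; apply/val_inj/mul1mx. Qed.
Lemma SL_mulg1 : right_id SL_one SL_mul.
Proof. by move=> M; apply/val_inj/mulmx1. Qed.
Lemma SL_mulVg : left_inverse SL_one SL_inv SL_mul.
Proof. by move=> M; apply/val_inj/mulVmx/SL_unitmx. Qed.
Lemma SL_mulgV : right_inverse SL_one SL_inv SL_mul.
Proof. by move=> M; apply/val_inj/mulmxV/SL_unitmx. Qed.

HB.instance Definition _ := isGroup.Build (SL n R)
  SL_mulA SL_mul1g SL_mulg1 SL_mulVg SL_mulgV.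

End SL.

Definition character (G : groupType) (n : nat) (R : comUnitRingType)
  (rho : {multiplicative G -> SL n R}) (eta : G) : R := \tr (SLval (rho eta)).

Definition pi1 : groupType := free_group 'I_3.

Definition alpha : pi1 := free_gen (0 : 'I_3).
Definition beta  : pi1 := free_gen (1 : 'I_3).
Definition gamma : pi1 := free_gen (2 : 'I_3).

(* The homomorphism alpha |-> g0, beta |-> g1, gamma |-> g2. *)
Definition pi1_lift (G : groupType) (g0 g1 g2 : G) : {multiplicative pi1 -> G} :=
  free_lift (tnth [tuple g0; g1; g2]).

Lemma pi1_liftE (G : groupType) (g0 g1 g2 : G) :
  [/\ pi1_lift g0 g1 g2 alpha = g0, pi1_lift g0 g1 g2 beta = g1
    & pi1_lift g0 g1 g2 gamma = g2].
Proof. by split; rewrite /pi1_lift [LHS]free_lift_gen. Qed.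

Definition phi_beta : {multiplicative pi1 -> pi1} :=
  pi1_lift (alpha^-1)%g (alpha^-1 * beta^-1 * alpha)%g
           ((beta * alpha)^-1 * gamma^-1 * (beta * alpha))%g.

Lemma pi1_ext (G : groupType) (f h : {multiplicative pi1 -> G}) :
  f alpha = h alpha -> f beta = h beta -> f gamma = h gamma -> f =1 h.
Proof.
move=> fa fb fc g; rewrite (free_lift_uniq (frefl (h \o @free_gen 'I_3))).
apply: free_lift_uniq => i.
case: i => -[|[|[|//]]] i3 /=.
- by rewrite (_ : Ordinal i3 = 0) //; apply: val_inj.
- by rewrite (_ : Ordinal i3 = 1) //; apply: val_inj.
- by rewrite (_ : Ordinal i3 = 2) //; apply: val_inj.
Qed.

Lemma phi_betaE :
  [/\ phi_beta alpha = (alpha^-1)%g,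
      phi_beta beta = (alpha^-1 * beta^-1 * alpha)%g
    & phi_beta gamma = ((beta * alpha)^-1 * gamma^-1 * (beta * alpha))%g].
Proof. exact: pi1_liftE. Qed.

Lemma phi_betaK : involutive phi_beta.
Proof.
have [pa pb pc] := phi_betaE.
have pba : phi_beta (beta * alpha)%g = ((beta * alpha)^-1)%g.
  by rewrite gmulfM pa pb mulgK invgM.
have Ka : phi_beta (phi_beta alpha) = alpha by rewrite pa multV pa invgK.
have Kb : phi_beta (phi_beta beta) = beta.
  by rewrite pb !gmulfM !multV pa pb !invgM !invgK !mulgA mulgV mul1g mulgK.
have Kc : phi_beta (phi_beta gamma) = gamma.
  move: pba pc; move: (beta * alpha)%g => d pd pc.
  by rewrite pc !gmulfM !multV pd pc !invgM !invgK !mulgA mulgV mul1g mulgK.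
exact: (@pi1_ext _ (phi_beta \o phi_beta) idfun).
Qed.

Lemma phi_beta_bij : bijective phi_beta.
Proof. exact: inv_bij phi_betaK. Qed.

Section Representation.
Variable R : realType.

Definition mx2 (p q r s : R) : 'M[R]_2 :=
  \matrix_(i, j) if i == 0 then (if j == 0 then p else q)
                           else (if j == 0 then r else s).

Lemma det_mx2 p q r s : \det (mx2 p q r s) = p * s - q * r.
Proof.
rewrite (expand_det_row _ 0) !big_ord_recl big_ord0 addr0 /cofactor !det_mx11.
by rewrite !mxE /= expr0 expr1 mul1r mulN1r mulrN.
Qed.

Definition mxA (a : R) := mx2 1 0 a 1.
Definition mxB (b : R) := mx2 (1 + b) (- b) b (1 - b).
Definition mxC (c : R) := mx2 1 (- c) 0 1.

Lemma det_mxA a : \det (mxA a) == 1.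
Proof. by rewrite det_mx2 mulr1 mul0r subr0. Qed.
Lemma det_mxB b : \det (mxB b) == 1.
Proof. by rewrite det_mx2 mulNr opprK [X in X + _]mulrC -subr_sqr expr1n subrK. Qed.
Lemma det_mxC c : \det (mxC c) == 1.
Proof. by rewrite det_mx2 mulr1 mulr0 subr0. Qed.

Definition rho (x : R * R * R) : {multiplicative pi1 -> SL 2 R} :=
  let: (a, b, c) := x in
  pi1_lift (MkSL (det_mxA a)) (MkSL (det_mxB b)) (MkSL (det_mxC c)).

Definition I_b (x : R * R * R) : R * R * R :=
  let: (a, b, c) := x in (a * (b - 1), b / (b - 1), c * (b - 1)).

End Representation.

(* Main.v *)
(** Since phi_beta is, up to conjugation by alpha, the map
    alpha |-> alpha^-1, beta |-> beta^-1, gamma |-> beta^-1 gamma^-1 beta,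
    and A, B, C are unipotent with fixed lines e2, (1, 1), e1, the two
    representations are conjugate under P A, where P = [[1, 0], [b, 1 - b]] is
    the matrix fixing the first two lines and sending the fixed line of
    B^-1 C^-1 B, spanned by (1 - b, -b), to e1. As det P = 1 - b need not be a
    square, the conjugation is by an element of GL_2(R), not of SL_2(R). *)
Require Import Defs.
From HB Require Import structures.
From mathcomp Require Import all_boot all_order all_fingroup all_algebra.
From mathcomp Require Import reals ring.

Set Implicit Arguments.
Unset Strict Implicit.
Unset Printing Implicit Defensive.

Import GRing.Theory.
Local Open Scope ring_scope.

Section Conjugation.
Variables (n : nat) (R : comUnitRingType) (Q : 'M[R]_n).
Hypothesis Qu : Q \in unitmx.

Lemma SL_conj_subproof (M : SL n R) : \det (Q *m M *m invmx Q) == 1.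
Proof.
rewrite !det_mulmx (eqP (SLvalP M)) mulr1 det_inv mulrV // -unitmxE.
Qed.

Definition SL_conj (M : SL n R) : SL n R := MkSL (SL_conj_subproof M).

Lemma SL_conj1 : SL_conj 1%g = 1%g.
Proof. by apply: val_inj; rewrite /= mulmx1 mulmxV. Qed.

Lemma SL_conjM : {morph SL_conj : M N / (M * N)%g}.
Proof. by move=> M N; apply: val_inj; rewrite /= !mulmxA mulmxKV. Qed.

HB.instance Definition _ :=
  isUMagmaMorphism.Build (SL n R) (SL n R) SL_conj (SL_conj1, SL_conjM).

Lemma mxtrace_SL_conj (M : SL n R) : \tr (SL_conj M) = \tr M.
Proof. by rewrite mxtrace_mulC mulmxA mulVmx // mul1mx. Qed.

Lemma SL_conj_eq (M N : SL n R) : Q *m M = N *m Q -> SL_conj M = N.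
Proof. by move=> QM; apply: val_inj; rewrite /= QM mulmxK. Qed.

(** Conjugation by [Q] is a homomorphism, so agreement on the three generators extends to all of
    [pi1], and the trace ignores conjugation. The intertwining form keeps [invmx Q] out of the
    matrix computations. *)
Lemma character_intertwined (f h : {multiplicative pi1 -> SL n R}) :
  Q *m f alpha = h alpha *m Q -> Q *m f beta = h beta *m Q ->
  Q *m f gamma = h gamma *m Q -> character f =1 character h.
Proof.
move=> /SL_conj_eq fa /SL_conj_eq fb /SL_conj_eq fc g.
rewrite /character -mxtrace_SL_conj; congr (\tr (SLval _)).
exact: (pi1_ext (f := SL_conj \o f) fa fb fc g).
Qed.

End Conjugation.

Section Mx2.
Variable R : realType.

Lemma mulmx_mx2 (p q r s p' q' r' s' : R) :
  mx2 p q r s *m mx2 p' q' r' s' =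
  mx2 (p * p' + q * r') (p * q' + q * s') (r * p' + s * r') (r * q' + s * s').
Proof.
apply/matrixP => i j; rewrite !mxE !big_ord_recl big_ord0 !mxE /= addr0.
by case: (i == 0); case: (j == 0).
Qed.

Lemma mx2_1 : mx2 1 0 0 1 = 1%:M :> 'M[R]_2.
Proof. by apply/matrixP => -[[|[|//]] ?] [[|[|//]] ?]; rewrite !mxE. Qed.

Lemma SL2_invE (M : SL 2 R) (N : 'M[R]_2) :
  N *m M = mx2 1 0 0 1 -> SLval (M^-1)%g = N.
Proof.
by move=> NM; rewrite -[RHS](mulmxK (SL_unitmx M)) NM mx2_1 mul1mx.
Qed.

(** Each of [mxA], [mxB], [mxC] has the form 1 + t N with N^2 = 0, so inversion negates the
    parameter t. *)
Lemma SL_mxA_inv (a : R) : SLval (MkSL (det_mxA a))^-1%g = mxA (- a).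
Proof. by apply: SL2_invE; rewrite mulmx_mx2; congr mx2; ring. Qed.

Lemma SL_mxB_inv (b : R) : SLval (MkSL (det_mxB b))^-1%g = mxB (- b).
Proof. by apply: SL2_invE; rewrite mulmx_mx2; congr mx2; ring. Qed.

Lemma SL_mxC_inv (c : R) : SLval (MkSL (det_mxC c))^-1%g = mxC (- c).
Proof. by apply: SL2_invE; rewrite mulmx_mx2; congr mx2; ring. Qed.

End Mx2.

Theorem corollary5p1p2 (R : realType) (a b c : R) (hb : b != 1) :
  character (rho (a, b, c) \o phi_beta) =1 character (rho (I_b (a, b, c))).
Proof.
have b1 : b - 1 != 0 by rewrite subr_eq0.
have SLM (M N : SL 2 R) : SLval (M * N)%g = M *m N by [].
pose Q := mx2 1 0 b (1 - b) *m mxA a.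
have Qu : Q \in unitmx.
  rewrite unitmxE det_mulmx (eqP (det_mxA a)) mulr1 det_mx2 mul1r mul0r subr0.
  by rewrite unitfE subr_eq0 eq_sym.
have [pa pb pc] := phi_betaE.
have [ra rb rc] := pi1_liftE (MkSL (det_mxA a)) (MkSL (det_mxB b))
  (MkSL (det_mxC c)).
have [ia ib ic] := pi1_liftE (MkSL (det_mxA (a * (b - 1))))
  (MkSL (det_mxB (b / (b - 1)))) (MkSL (det_mxC (c * (b - 1)))).
pose f := rho (a, b, c); pose h := rho (I_b (a, b, c)).
apply: (character_intertwined Qu).
- change (Q *m f (phi_beta alpha) = h alpha *m Q).
  rewrite pa multV ra ia SL_mxA_inv /Q !mulmx_mx2.
  by congr mx2; ring.
- change (Q *m f (phi_beta beta) = h beta *m Q).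
  rewrite pb !gmulfM !multV ra rb ib !SLM SL_mxA_inv SL_mxB_inv /Q !mulmx_mx2.
  (* Only here does a denominator occur, from [b / (b - 1)]; [b1] discharges the side condition. *)
  by congr mx2; field.
- change (Q *m f (phi_beta gamma) = h gamma *m Q).
  (* [invgM] splits the inverse of [beta * alpha], leaving only inverses of single generators, whose
     matrices are known. *)
  rewrite pc invgM !gmulfM !multV ra rb rc ic !SLM.
  rewrite SL_mxA_inv SL_mxB_inv SL_mxC_inv /Q !mulmx_mx2.
  by congr mx2; ring.
Qed.
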